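(* Let $X$ be a Hausdorff space and let $I$ be an interval in $\mathbb{R}$ closed and bounded on the left with left endpoint $t_0$. Let $\mathcal{U}$ be a subset of $\mathcal{X}=\mathcal{C}_{\mathrm{loc}}(I,X)$. Consider a net $\{S_\varepsilon\}_{\varepsilon\in\mathcal{E}}$ of (Borel) measurable functions $S_\varepsilon:X\to\mathcal{X}$ and a net $\{\mu_\varepsilon\}_{\varepsilon\in\mathcal{E}}$ of tight Borel probability measures on $X$. Set $\mathcal{U}_\varepsilon=S_\varepsilon(X)$ and define $P_\varepsilon=\Pi_{t_0}S_\varepsilon:X\to X$. Assume that (H1) $P_\varepsilon\mu_\varepsilon\stackrel{wsc*}{\rightharpoonup}\mu_0$ for some tight Borel probability measure $\mu_0$ on $X$. Moreover, suppose that there exists a sequence $\{K_n\}_{n\in\mathbb{N}}$ of compact sets in $X$ with the following properties: (H2) the map $S_\varepsilon|_{K_n}:K_n\to\mathcal{X}$ is continuous for all $n\in\mathbb{N}$ and all $\varepsilon\in\mathcal{E}$, with $K_n$ having the topology inherited from $X$; (H3) $\mu_\varepsilon(X\setminus K_n)\le\delta_n$ for all $\varepsilon\in\mathcal{E}$ and all $n\in\mathbb{N}$, where $\delta_n\to0$ as $n\to\infty$; (H4) for each $n$ there exists a compact set $\mathcal{K}_n$ in $\mathcal{X}$ with $S_\varepsilon(K_n)\subset\mathcal{K}_n$ for all $\varepsilon\in\mathcal{E}$; (H5) for each $n\in\mathbb{N}$, $\limsup_{\varepsilon\in\mathcal{E}}S_\varepsilon(K_n)\subset\mathcal{U}$.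 Then each $\rho_\varepsilon=S_\varepsilon\mu_\varepsilon$ is a $\mathcal{U}_\varepsilon$-trajectory statistical solution, and the net $\{\rho_\varepsilon\}_{\varepsilon\in\mathcal{E}}$ has a convergent subnet, with respect to the weak-star semicontinuity topology, to a $\mathcal{U}$-trajectory statistical solution $\rho$ such that $\Pi_{t_0}\rho=\mu_0$.
   Context: $\mathcal{C}_{\mathrm{loc}}(I,X)$ is the space of continuous functions $u:I\to X$ endowed with the compact-open topology (uniform convergence on compact subsets of $I$). For $t\in I$, $\Pi_t:\mathcal{X}\to X$ is $\Pi_t u=u(t)$. For a Borel measurable map $F$ and a measure $\mu$, $F\mu$ denotes the push-forward measure $F\mu(E)=\mu(F^{-1}(E))$. A finite Borel measure $\mu$ on a Hausdorff space $Y$ is tight if $\mu(A)=\sup\{\mu(K):K\subset A,\ K \text{ compact}\}$ for every Borel set $A\subset Y$. The weak-star semicontinuity topology on the finite Borel measures on $Y$ is the smallest topology for which $\mu\mapsto\int_Y f\,d\mu$ is upper semicontinuous for every bounded upper semicontinuous $f:Y\to\mathbb{R}$; convergence of nets in it is written $\mu_\alpha\stackrel{wsc*}{\rightharpoonup}\mu$. For $\mathcal{U}\subset\mathcal{X}$, a Borel probability measure $\rho$ on $\mathcal{X}$ is a $\mathcal{U}$-trajectory statistical solution if (i) $\rho$ is tight, and (ii) there is a Borel set $\mathcal{V}$ of $\mathcal{X}$ with $\mathcal{V}\subset\mathcal{U}$ and $\rho(\mathcal{X}\setminus\mathcal{V})=0$. For a net $\{A_\gamma\}_{\gamma\in\Gamma}$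 of subsets of a topological space, indexed by a directed set $(\Gamma,\preccurlyeq)$, the topological superior limit is $\limsup_\gamma A_\gamma=\bigcap_{\gamma\in\Gamma}\overline{\bigcup_{\gamma\preccurlyeq\beta}A_\beta}$; in (H5) it is taken in $\mathcal{X}$. *)

(* Defs.v *)
From HB Require Import structures.
From mathcomp Require Import all_boot all_order all_algebra finmap.
From mathcomp Require Import all_classical all_reals all_analysis.

Set Implicit Arguments.
Unset Strict Implicit.
Unset Printing Implicit Defensive.

Import Order.TTheory GRing.Theory Num.Theory.
Import numFieldNormedType.Exports.

Local Open Scope classical_set_scope.
Local Open Scope ring_scope.

Definition directed (E : Type) (le : E -> E -> Prop) : Prop :=
  [/\ [set: E] !=set0,
      forall a, le a a,
      forall a b c, le a b -> le b c -> le a c &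
      forall a b, exists2 c, le a c & le b c].

(* A net [x : E -> T] converges to [l] when [x @ tails le --> l]. *)
Definition tails (E : Type) (le : E -> E -> Prop) : set_system E :=
  filter_from [set: E] (fun a => [set b | le a b]).

Lemma tails_filter (E : Type) (le : E -> E -> Prop) :
  directed le -> ProperFilter (tails le).
Proof.
case=> -[e _] ler let_ led; split.
  by case=> a _ /(_ a) /=; apply; exact: ler.
apply: filter_from_filter; first by exists e.
move=> a b _ _; have [c ac bc] := led a b.
by exists c => // d /= cd; split; [exact: let_ cd|exact: let_ cd].
Qed.

(* Reindexings [h] for which [x \o h] is a subnet of the net [x].  This is the
   monotone and cofinal variant, which implies the variant asking only that [h]
   be eventually above each index. *)
Definition subnet_index (E L : Type) (leE : E -> E -> Prop)
    (leL : L -> L -> Prop) (h : L -> E) : Prop :=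
  (forall a b, leL a b -> leE (h a) (h b)) /\
  (forall e, exists l, leE e (h l)).

Definition net_limsup (E : Type) (le : E -> E -> Prop) (T : topologicalType)
    (A : E -> set T) : set T :=
  \bigcap_(a in [set: E]) closure (\bigcup_(b in [set b | le a b]) A b).

Definition Cloc (T X : topologicalType) : Type := continuousType T X.

HB.instance Definition _ (T X : topologicalType) :=
  Choice.on (Cloc T X).
HB.instance Definition _ (T X : topologicalType) :=
  Topological.copy (Cloc T X)
    (initial_topology
       ((fun u : continuousType T X => u : T -> X)
         : continuousType T X -> {compact-open, T -> X})).
HB.instance Definition _ (T : topologicalType) (X : ptopologicalType) :=
  isPointed.Build (Cloc T X) (cst point : continuousType T X).

Notation borel T := (g_sigma_algebraType (@open T)).

Lemma continuous_borel_measurable (S T : ptopologicalType) (f : S -> T) :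
  continuous f -> measurable_fun [set: borel S] (f : borel S -> borel T).
Proof.
move=> cf; apply: (@measurability _ _ (borel S) (borel T) setT f (@open T)) => //.
move=> _ [B oB <-]; rewrite setTI; apply: sub_sigma_algebra.
by move/continuousP: cf; apply.
Qed.

Definition Pi (T : topologicalType) (X : ptopologicalType) (t : T)
    (u : borel (Cloc T X)) : borel X :=
  (u : continuousType T X) t.

Lemma Pi_continuous (T : topologicalType) (X : ptopologicalType) (t : T) :
  continuous (Pi t : Cloc T X -> X).
Proof.
apply/continuousP => O oO.
exists ([set g : {compact-open, T -> X} | g @` [set t] `<=` O]).
  exact: compact_open_open (@compact_set1 _ _) oO.
rewrite /Pi; apply/seteqP; split=> u /=; first by apply; exists t.
by move=> uO _ [s -> <-].
Qed.

HB.instance Definition _ (T : topologicalType) (X : ptopologicalType) (t : T) :=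
  isMeasurableFun.Build _ _ (borel (Cloc T X)) (borel X) (@Pi T X t)
    (continuous_borel_measurable (@Pi_continuous T X t)).

Definition upper_semicontinuous (Y : topologicalType) (R : realType)
    (f : Y -> R) : Prop :=
  forall x a, f x < a -> \forall y \near x, f y < a.

Definition tight (R : realType) (Y : ptopologicalType)
    (mu : {finite_measure set (borel Y) -> \bar R}) : Prop :=
  forall A : set (borel Y), measurable A ->
    mu A = ereal_sup [set mu K | K in [set K : set Y | compact K /\ K `<=` A]].

(* Finite Borel measures with the weak-star semicontinuity topology.  Two
   elements that agree on Borel sets need not be equal, as a measure is a
   function on all sets, but they are topologically indistinguishable. *)
Definition wsc_measure (R : realType) (Y : ptopologicalType) : Type :=
  {finite_measure set (borel Y) -> \bar R}.

Definition wsc (R : realType) (Y : ptopologicalType)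
    (mu : {finite_measure set (borel Y) -> \bar R}) : wsc_measure R Y := mu.

Definition wsc_int (R : realType) (Y : ptopologicalType) (f : Y -> R)
    (mu : wsc_measure R Y) : R :=
  \int[(mu : {finite_measure set (borel Y) -> \bar R})]_y f y.

Definition wsc_subbase (R : realType) (Y : ptopologicalType) :
    set_system (wsc_measure R Y) :=
  [set U | exists f : Y -> R, exists a : R,
    [/\ upper_semicontinuous f, bounded_fun f &
        U = [set mu | wsc_int f mu < a]]].

HB.instance Definition _ (R : realType) (Y : ptopologicalType) :=
  gen_eqMixin (wsc_measure R Y).
HB.instance Definition _ (R : realType) (Y : ptopologicalType) :=
  gen_choiceMixin (wsc_measure R Y).
HB.instance Definition _ (R : realType) (Y : ptopologicalType) :=
  isSubBaseTopological.Build (wsc_measure R Y) (@wsc_subbase R Y) id.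

Lemma wsc_int_upper_semicontinuous (R : realType) (Y : ptopologicalType)
    (f : Y -> R) :
  upper_semicontinuous f -> bounded_fun f -> upper_semicontinuous (wsc_int f).
Proof.
move=> uf bf mu a fa; exists [set nu | wsc_int f nu < a]; split => //.
exists [set [set nu | wsc_int f nu < a]]; last by rewrite bigcup_set1.
move=> _ ->; exists (fset1 [set nu | wsc_int f nu < a]).
  by move=> _ /[!inE] ->; exists f, a.
by rewrite set_fset1 bigcap_set1.
Qed.

Lemma wsc_smallest (R : realType) (Y : ptopologicalType)
    (tau : Topological (wsc_measure R Y)) :
  (forall f : Y -> R, upper_semicontinuous f -> bounded_fun f ->
     @upper_semicontinuous (Topological.Pack tau) R (wsc_int f)) ->
  @open (wsc_measure R Y) `<=` @open (Topological.Pack tau).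
Proof.
move=> utau _ [B Bfin <-]; apply: bigcup_open => _ /Bfin[F Fsub <-].
rewrite bigcap_fset big_seq.
apply: big_ind => [|U V|U UF]; [exact: openT|exact: openI|].
have := Fsub _ UF; rewrite inE => -[f [a [uf bf ->]]].
by rewrite openE => nu /= fa; exact: utau.
Qed.

Definition trajectory_statistical_solution (R : realType)
    (T : topologicalType) (X : ptopologicalType) (U : set (Cloc T X))
    (rho : probability (borel (Cloc T X)) R) : Prop :=
  tight rho /\
  exists V : set (borel (Cloc T X)),
    [/\ measurable V, V `<=` U & rho (~` V) = 0%E].

(* Main.v *)
Require Import Defs.
From HB Require Import structures.
From mathcomp Require Import all_boot all_order all_algebra.
From mathcomp Require Import lra.
From mathcomp Require Import all_classical all_reals all_analysis.

(** The laws [rho_e] of [S e] under [mu e] put mass at least [1 - delta n] on a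
    compact set of trajectories that does not depend on [e], so a compactness
    argument applies.  The space of trajectories is only Hausdorff: there may
    be few continuous functions on it, and the limit measure is not obtained
    from a representation theorem but built by hand.

    Let [UU] be an ultrafilter of indices finer than the tails of the net, and
    [lam G] the limit of [rho_e G] along [UU]; [lam] is finitely additive on
    open sets.  Approximating [lam] from outside by open sets, the result from
    inside by compact sets, and the result again from outside by open sets
    gives an outer measure for which open sets are Caratheodory measurable.
    This holds in every Hausdorff space, because disjoint compact sets have
    disjoint open neighbourhoods ([exists_radon_extension]).  The measure [rho]
    so obtained satisfies [rho G <= lam G] for [G] open, and uniform tightness
    prevents a loss of mass, so [rho] is a tight probability
    ([exists_ultra_limit]).

    On open sets, [rho G <= lam G] is one half of a portmanteau theorem:
    together with the equality of the total masses it bounds the upper limits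
    of [rho_e C] for [C] closed, hence those of the integrals of bounded upper
    semicontinuous functions, which are uniform limits of combinations of
    indicators of closed sets ([open_liminf_wsc_cvg]).  Pairing the members of
    [UU] with their elements turns the ultrafilter into a subnet
    ([proper_filter_subnet]).

    The closure [F] of the union of the [S b @` K n] with [b] above [a] has
    [rho_b]-mass at least [1 - delta n] for all such [b], hence also
    [rho]-mass at least [1 - delta n].  These closed sets decrease to the
    superior limit of the [S e @` K n], and a tight measure is continuous along
    directed families of open sets ([tight_directed_bigcup]), so the superior
    limits, which lie in [U], carry [rho].

    Finally, [mu0] and the law of [Pi t0] under [rho] are both tight and are
    both limits of the same net along [UU]; since disjoint compact sets can be
    separated, they coincide ([tight_limit_le]). *)

Set Implicit Arguments.
Unset Strict Implicit.
Unset Printing Implicit Defensive.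

Import Order.TTheory GRing.Theory Num.Theory.
Import numFieldNormedType.Exports.

Local Open Scope classical_set_scope.
Local Open Scope ring_scope.

(** * Compact sets in Hausdorff spaces *)

(** A compact set is separated from a filter as soon as each of its points is.
    Used twice below: with the neighbourhoods of a point, then with those of a
    compact set. *)
Lemma compact_disjoint_filter (T : topologicalType) (F : set_system T)
    (L : set T) : ProperFilter F -> compact L ->
  (forall x, L x -> exists U V, [/\ F U, nbhs x V & U `&` V = set0]) ->
  exists U V, [/\ F U, open V, L `<=` V & U `&` V = set0].
Proof.
move=> FF /compact_near_coveringP cL sepL.
have LF : \forall U \near powerset_filter_from F, L `<=` ~` closure U.
  apply: cL => x /sepL[U0 [V [FU0 xV UV0]]].
  exists (V°, [set U | U `<=` U0]) => /=.
    by split; [exact: nbhs_interior|exact: small_set_sub].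
  move=> [y U] /= [yV UU0] /(_ _ yV)[z [Uz Vz]].
  by rewrite -[False]/(set0 z) -UV0; split=> //; exact: UU0.
have [U [FU LU]] := filter_ex (filterI (near_small_set FF) LF).
exists U, (~` closure U); split => //.
  exact/closed_openC/closed_closure.
by rewrite -subset0 => x [/subset_closure Ux /(_ Ux)].
Qed.

Lemma hausdorff_compact_separation (T : topologicalType) (K L : set T) :
  hausdorff_space T -> compact K -> compact L -> K `&` L = set0 ->
  exists U V, [/\ open U, open V, K `<=` U, L `<=` V & U `&` V = set0].
Proof.
rewrite open_hausdorff => hT cK cL KL0.
have [->|/set0P/set_nbhs_pfilter KF] := eqVneq K set0.
  by exists set0, setT; split; [exact: open0|exact: openT| | |rewrite set0I].
have [U [V [KU oV LV UV0]]] : exists U V,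
    [/\ set_nbhs K U, open V, L `<=` V & U `&` V = set0].
  apply: (compact_disjoint_filter _ cL) => y Ly.
  have [V [U [yV oU KU VU0]]] : exists V U,
      [/\ nbhs y V, open U, K `<=` U & V `&` U = set0].
    apply: (compact_disjoint_filter _ cK) => x Kx.
    have xy : y != x.
      apply: contraPneq KL0 => yx; apply/eqP/set0P; exists x.
      by split=> //; rewrite -yx.
    have [[A B] /= [] + + [oA oB /eqP AB0]] := hT _ _ xy.
    by rewrite !inE => Ay Bx; exists A, B; split=> //; exact: open_nbhs_nbhs.
  exists U, V; split=> //; last by rewrite setIC.
  by apply/set_nbhsP; exists U; split.
exists (U°), V; split=> //; first exact: open_interior.
by rewrite -subset0 => x [/interior_subset Ux Vx]; rewrite -UV0.
Qed.

(** [K `\` G] and [K `\` H] are disjoint compact sets; removing from [K]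
    disjoint neighbourhoods of them leaves the two pieces. *)
Lemma compact_setU_decomp (T : topologicalType) (K G H : set T) :
  hausdorff_space T -> compact K -> open G -> open H -> K `<=` G `|` H ->
  exists K1 K2, [/\ compact K1, compact K2, K1 `<=` G, K2 `<=` H &
                    K = K1 `|` K2].
Proof.
move=> hT cK oG oH KGH.
have [|U [V [oU oV KU KV UV0]]] := hausdorff_compact_separation hT
  (compact_closedI cK (open_closedC oG)) (compact_closedI cK (open_closedC oH)).
  by rewrite -subset0 => x [[Kx nG] [_ nH]]; case: (KGH _ Kx).
exists (K `&` ~` U), (K `&` ~` V); split.
- exact/compact_closedI/open_closedC.
- exact/compact_closedI/open_closedC.
- by move=> x [Kx nUx]; apply: contrapT => nGx; apply/nUx/KU.
- by move=> x [Kx nVx]; apply: contrapT => nHx; apply/nVx/KV.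
- by rewrite -setIUr -setCI UV0 setC0 setIT.
Qed.

Lemma compact_countable_subcover (T : topologicalType) (K : set T)
    (G : nat -> set T) : compact K -> (forall n, open (G n)) ->
  K `<=` \bigcup_n G n -> exists n, K `<=` \big[setU/set0]_(i < n) G i.
Proof.
move=> /compact_near_coveringP cK oG KG.
have : \forall n \near \oo, K `<=` \big[setU/set0]_(i < n) G i.
  apply: cK => x /KG[m _ Gmx].
  exists (G m, [set n | (m < n)%N]) => /=.
    by split; [exact: open_nbhs_nbhs|exists m.+1].
  by move=> [y n] /= [Gmy mn]; rewrite -bigcup_mkord; exists m.
by move=> /filter_ex[n Kn]; exists n.
Qed.

(** * From a content on open sets to a Radon measure *)

Section radon_extension.
Context (R : realType) (Y : ptopologicalType).
Implicit Types (lam : set Y -> \bar R) (A G K : set Y).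
Local Open Scope ereal_scope.

Definition outer_open lam A : \bar R :=
  ereal_inf [set lam G | G in [set G | open G /\ A `<=` G]].

Definition inner_compact lam A : \bar R :=
  ereal_sup [set lam K | K in [set K | compact K /\ K `<=` A]].

Lemma outer_open_le lam A G : open G -> A `<=` G -> outer_open lam A <= lam G.
Proof. by move=> oG AG; apply: ereal_inf_lbound; exists G. Qed.

Lemma le_outer_open lam A B : A `<=` B -> outer_open lam A <= outer_open lam B.
Proof.
move=> AB; apply: ereal_inf_le_tmp => _ [G [oG BG] <-]; exists G => //.
by split=> //; exact: subset_trans BG.
Qed.

Lemma inner_compact_ge lam A K : compact K -> K `<=` A ->
  lam K <= inner_compact lam A.
Proof. by move=> cK KA; apply: ereal_sup_ubound; exists K. Qed.

Lemma le_inner_compact lam A B : A `<=` B ->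
  inner_compact lam A <= inner_compact lam B.
Proof.
move=> AB; apply: ereal_sup_le => _ [K [cK KA] <-]; exists K => //.
by split=> //; exact: subset_trans AB.
Qed.

(** The properties of a finite measure on open sets that persist in pointwise
    limits. *)
Definition open_content lam :=
  [/\ lam set0 = 0, lam setT < +oo,
      (forall G H, open G -> open H -> G `<=` H -> lam G <= lam H),
      (forall G H, open G -> open H -> lam (G `|` H) <= lam G + lam H) &
      (forall G H, open G -> open H -> G `&` H = set0 ->
        lam G + lam H <= lam (G `|` H))].

Context (hY : hausdorff_space Y) (lam : set Y -> \bar R).
Context (lamP : open_content lam).

Local Notation kap := (outer_open lam).
Local Notation tau := (inner_compact kap).
Local Notation rho := (outer_open tau).

Let lam_ge0 G : open G -> 0 <= lam G.
Proof.
by have [l0 _ lS _ _] := lamP; move=> oG; rewrite -l0 lS//; exact: open0.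
Qed.

Let kap_ge0 A : 0 <= kap A.
Proof. by apply: le_ereal_inf_tmp => _ [G [oG _] <-]; exact: lam_ge0. Qed.

Let kap0 : kap set0 = 0.
Proof.
apply/eqP; rewrite eq_le kap_ge0 andbT; have [l0 _ _ _ _] := lamP.
by rewrite -[leRHS]l0 outer_open_le//; exact: open0.
Qed.

Let kap_fin A : kap A \is a fin_num.
Proof.
rewrite ge0_fin_numE//; have [_ lT _ _ _] := lamP; apply: le_lt_trans lT.
by apply: outer_open_le => //; exact: openT.
Qed.

Let kapU K1 K2 : kap (K1 `|` K2) <= kap K1 + kap K2.
Proof.
have [_ _ _ lU _] := lamP; apply/lee_addgt0Pr => e e0.
have e20 : (0 < e / 2)%R by rewrite divr_gt0.
have [_ [G1 [oG1 KG1] <-] ltG1] := lb_ereal_inf_adherent e20 (kap_fin K1).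
have [_ [G2 [oG2 KG2] <-] ltG2] := lb_ereal_inf_adherent e20 (kap_fin K2).
apply: (@le_trans _ _ (lam (G1 `|` G2))).
  by apply: outer_open_le; [exact: openU|exact: setUSS].
apply: (le_trans (lU _ _ oG1 oG2)); rewrite [e]splitr EFinD addeACA.
by apply: leeD; exact: ltW.
Qed.

(** A neighbourhood of the union contains disjoint neighbourhoods of the two
   sets, on which [lam] is additive. *)
Let kapU_disjoint K1 K2 : compact K1 -> compact K2 -> K1 `&` K2 = set0 ->
  kap K1 + kap K2 <= kap (K1 `|` K2).
Proof.
move=> cK1 cK2 K120; have [_ _ lS _ lD] := lamP.
have [U [V [oU oV KU KV UV0]]] := hausdorff_compact_separation hY cK1 cK2 K120.
apply: le_ereal_inf_tmp => _ [G [oG KG] <-].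
have [K1G K2G] : K1 `<=` G /\ K2 `<=` G by rewrite -subUset.
apply: (@le_trans _ _ (lam (G `&` U) + lam (G `&` V))).
  by apply: leeD; apply: outer_open_le; [exact: openI|rewrite subsetI|
     exact: openI|rewrite subsetI].
apply: le_trans (lD _ _ (openI oG oU) (openI oG oV) _) _.
  by rewrite setIACA UV0 setI0.
apply: lS => //; first by apply: openU; exact: openI.
by rewrite -setIUr; exact: subIsetl.
Qed.

Let tau_ge0 A : 0 <= tau A.
Proof.
by rewrite -kap0; apply: inner_compact_ge => //; exact: compact0.
Qed.

Let tau_le G : open G -> tau G <= lam G.
Proof.
by move=> oG; apply: ge_ereal_sup => _ [K [cK KG] <-]; exact: outer_open_le.
Qed.

Let tau_fin G : open G -> tau G \is a fin_num.
Proof.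
move=> oG; rewrite ge0_fin_numE//; have [_ lT lS _ _] := lamP.
apply: le_lt_trans lT; apply: le_trans (tau_le oG) _.
by apply: lS => //; exact: openT.
Qed.

Let kap_le_sum n (G : nat -> set Y) K : (forall i, open (G i)) -> compact K ->
  K `<=` \big[setU/set0]_(i < n) G i -> kap K <= \sum_(i < n) tau (G i).
Proof.
move=> oG; elim: n K => [|n IHn] K cK.
  by rewrite !big_ord0 subset0 => ->; rewrite kap0.
rewrite !big_ord_recr/= => /(compact_setU_decomp hY cK _ (oG n))[].
  by rewrite -bigcup_mkord; exact: bigcup_open.
move=> K1 [K2 [cK1 cK2 KG1 KG2 ->]]; apply: le_trans (kapU _ _) _.
by apply: leeD; [exact: IHn|exact: inner_compact_ge].
Qed.

(** Compactness reduces countable subadditivity to finite subadditivity. *)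
Let tau_bigcup (G : nat -> set Y) : (forall i, open (G i)) ->
  tau (\bigcup_i G i) <= \sum_(i <oo) tau (G i).
Proof.
move=> oG; apply: ge_ereal_sup => _ [K [cK KG] <-].
have [n Kn] := compact_countable_subcover cK oG KG.
apply: le_trans (kap_le_sum oG cK Kn) _.
rewrite -(big_mkord xpredT (fun i => tau (G i))).
by apply: nneseries_lim_ge.
Qed.

Lemma radon_open G : open G -> rho G = tau G.
Proof.
move=> oG; apply/eqP; rewrite eq_le outer_open_le//=.
by apply: le_ereal_inf_tmp => _ [H [oH GH] <-]; exact: le_inner_compact.
Qed.

(** The inner approximation does not change the values on compact sets:
    [tau G <= lam G] for [G] open gives the inequality that could fail. *)
Lemma radon_compact K : compact K -> rho K = kap K.
Proof.
move=> cK; apply/eqP; rewrite eq_le; apply/andP; split.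
  apply: le_ereal_inf_tmp => _ [G [oG KG] <-].
  exact: le_trans (outer_open_le _ oG KG) (tau_le oG).
by apply: le_ereal_inf_tmp => _ [G [oG KG] <-]; exact: inner_compact_ge.
Qed.

Let rho_ge0 A : 0 <= rho A.
Proof. by apply: le_ereal_inf_tmp => _ [G _ <-]. Qed.

Let rho0 : rho set0 = 0.
Proof. by rewrite radon_compact ?kap0//; exact: compact0. Qed.

Let rho_fin A : rho A \is a fin_num.
Proof.
rewrite ge0_fin_numE//.
apply: le_lt_trans (outer_open_le _ openT (@subsetT _ A)) _.
by rewrite -ge0_fin_numE// tau_fin//; exact: openT.
Qed.

Let rho_sigma_subadditive : sigma_subadditive rho.
Proof.
move=> A; apply/lee_addgt0Pr => e e0.
have ei0 i : (0 < e / (2 ^ i.+1)%:R)%R by rewrite divr_gt0// ltr0n expn_gt0.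
have /choice[G GP] i : exists G, [/\ open G, A i `<=` G &
    tau G <= rho (A i) + (e / (2 ^ i.+1)%:R)%:E].
  have [_ [G [oG AG] <-] ltG] := lb_ereal_inf_adherent (ei0 i) (rho_fin (A i)).
  by exists G; split=> //; exact: ltW.
have oG i : open (G i) by case: (GP i).
apply: (@le_trans _ _ (tau (\bigcup_i G i))).
  apply: outer_open_le; first exact: bigcup_open.
  by apply: subset_bigcup => i _; case: (GP i).
apply: le_trans (tau_bigcup oG) _.
apply: le_trans (epsilon_trick _ (fun i => rho_ge0 (A i)) (ltW e0)).
by apply: lee_nneseries => // i _; case: (GP i).
Qed.

HB.instance Definition _ := isOuterMeasure.Build R Y rho
  rho0 rho_ge0 (@le_outer_open tau) rho_sigma_subadditive.

(** For [W] open, exhaust [W `&` G] by a compact set [K], then the open set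
   [W `&` ~` K], which contains [W `\` G], by a compact set [L]: [kap] is
   superadditive on the disjoint sets [K] and [L]. *)
Let open_caratheodory G : open G -> rho.-caratheodory G.
Proof.
move=> oG; apply: le_caratheodory_measurable => A /=.
apply: le_ereal_inf_tmp => _ [W [oW AW] <-].
apply: (@le_trans _ _ (rho (W `&` G) + rho (W `&` ~` G))).
  by apply: leeD; apply: le_outer_open; exact: setSI.
rewrite radon_open; last exact: openI.
apply/lee_addgt0Pr => e e0; have e20 : (0 < e / 2)%R by rewrite divr_gt0.
have [_ [K [cK KOG] <-] ltK] :=
  ub_ereal_sup_adherent e20 (tau_fin (openI oW oG)).
have oOK : open (W `&` ~` K).
  by apply: openI => //; exact: closed_openC (compact_closed hY cK).
have [_ [L [cL LOK] <-] ltL] := ub_ereal_sup_adherent e20 (tau_fin oOK).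
have KL0 : K `&` L = set0.
  by rewrite -subset0 => x [Kx /LOK[]].
have OGK : rho (W `&` ~` G) <= tau (W `&` ~` K).
  by apply: outer_open_le => // x [Ox nGx]; split => // /KOG[].
have KLO : kap K + kap L <= tau W.
  apply: le_trans (kapU_disjoint cK cL KL0) _.
  apply: inner_compact_ge; first exact: compactU.
  by rewrite subUset; split=> [x /KOG[]|x /LOK[]].
apply: le_trans (leeD2r e%:E KLO); rewrite [e]splitr EFinD addeACA.
apply: leeD; first by rewrite -leeBlDr // ltW.
by apply: le_trans OGK _; rewrite -leeBlDr// ltW.
Qed.

Lemma exists_radon_extension : exists m : {measure set (borel Y) -> \bar R},
  m = rho :> (set Y -> \bar R).
Proof.
have borel_cara : @measurable _ (borel Y) `<=` rho.-caratheodory.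
  apply: smallest_sub => [|G]; last exact: open_caratheodory.
  split.
  - exact: caratheodory_measurable_set0.
  - by move=> A mA; rewrite setTD; exact: caratheodory_measurable_setC.
  - by move=> A mA; exact: caratheodory_measurable_bigcup.
have rho_sadd : semi_sigma_additive (rho : set (borel Y) -> \bar R).
  move=> F mF tF mUF.
  apply: (@caratheodory_measure_sigma_additive R Y rho) => //.
  - by move=> i; exact: borel_cara.
  - exact: borel_cara.
pose m0 := isMeasure.Build _ (borel Y) R rho rho0 rho_ge0 rho_sadd.
pose m : {measure set (borel Y) -> \bar R} :=
  HB.pack (rho : set (borel Y) -> \bar R) m0.
by exists m.
Qed.

End radon_extension.

(** * Tight measures *)

Section tightness.
Context (R : realType) (Y : ptopologicalType).
Implicit Types m : probability (borel Y) R.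
Local Open Scope ereal_scope.

Lemma open_borel (G : set Y) : open G -> measurable (G : set (borel Y)).
Proof. exact: sub_sigma_algebra. Qed.

Lemma closed_borel (C : set Y) : closed C -> measurable (C : set (borel Y)).
Proof.
move=> cC; rewrite -[C]setCK; apply: measurableC.
by apply: open_borel; exact: closed_openC.
Qed.

Lemma compact_borel (K : set Y) : hausdorff_space Y -> compact K ->
  measurable (K : set (borel Y)).
Proof. by move=> hY cK; exact: closed_borel (compact_closed hY cK). Qed.

Lemma tightP (m : {finite_measure set (borel Y) -> \bar R}) :
  hausdorff_space Y ->
  tight m <-> (forall A : set (borel Y), measurable A -> forall e : R,
    (0 < e)%R -> exists K : set Y,
      [/\ compact K, K `<=` A & m A <= m K + e%:E]).
Proof.
move=> hY; split=> [tm A mA e e0|tm A mA].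
  have := tm A mA; set s := ereal_sup _ => mAs.
  have sfin : s \is a fin_num by rewrite -mAs; exact: fin_num_measure.
  have [_ [K [cK KA] <-] ltK] := ub_ereal_sup_adherent e0 sfin.
  by exists K; split=> //; rewrite mAs -leeBlDr// ltW.
apply/eqP; rewrite eq_le; apply/andP; split.
  apply/lee_addgt0Pr => e /(tm A mA)[K [cK KA mAK]]; apply: le_trans mAK _.
  by rewrite leeD2r//; apply: ereal_sup_ubound; exists K.
apply: ge_ereal_sup => _ [K [cK KA] <-].
by apply: le_measure => //; rewrite inE//; exact: compact_borel.
Qed.

(** If [G] is an open set slightly larger than the complement of [A] and [K] is
    a compact set of almost full measure, then [K `\` G] is a compact subset of
    [A] of almost the same measure. *)
Lemma outer_regular_tight m : hausdorff_space Y ->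
  (forall A : set (borel Y), measurable A -> forall e : R, (0 < e)%R ->
    exists G : set Y, [/\ open G, A `<=` G & m G <= m A + e%:E]) ->
  (forall e : R, (0 < e)%R -> exists K : set Y,
    compact K /\ m (~` K : set (borel Y)) <= e%:E) ->
  tight m.
Proof.
move=> hY regm cptm; apply/tightP => // A mA e e0.
have e20 : (0 < e / 2)%R by rewrite divr_gt0.
have [G [oG AG mG]] := regm _ (measurableC mA) _ e20.
have [K [cK mK]] := cptm _ e20.
have mbG := open_borel oG; have mbK := compact_borel hY cK.
exists (K `&` ~` G); split.
- exact: compact_closedI cK (open_closedC oG).
- by move=> x [_ nGx]; apply: contrapT => nAx; exact/nGx/AG.
have mGA : m (G `&` A) <= (e / 2)%:E.
  have := measureDI m mbG (measurableC mA).
  rewrite [X in _ = m X + _](_ : _ = G `&` A); last first.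
    by rewrite setDE setCK.
  rewrite (setIidr AG) => mGE; move: mG; rewrite mGE addeC leeD2lE//.
  by apply: fin_num_measure => //; exact: measurableC.
have mKG : measurable (K `&` ~` G : set (borel Y)).
  by apply: measurableI => //; exact: measurableC.
have mGIA : measurable (G `&` A : set (borel Y)) by exact: measurableI.
have mCK : measurable (~` K : set (borel Y)) by exact: measurableC.
apply: (@le_trans _ _ (m ((K `&` ~` G) `|` ((G `&` A) `|` ~` K)))).
  apply: le_measure; rewrite ?inE//; first by do 2 apply: measurableU => //.
  move=> x Ax; have [Kx|nKx] := pselect (K x); last by right; right.
  by have [Gx|nGx] := pselect (G x); [right; left|left].
apply: (le_trans (measureU2 _ _ _)) => //; first exact: measurableU.
rewrite leeD2l// [e]splitr EFinD; apply: (le_trans (measureU2 _ _ _)) => //.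
exact: leeD.
Qed.

End tightness.

Local Open Scope ereal_scope.

(** Given a compact subset of the preimage of [A], intersect it with a compact
    set of almost full measure on which [f] is continuous: the image of the
    intersection is a compact subset of [A]. *)
Lemma tight_pushforward (R : realType) (Y Z : ptopologicalType)
    (m : probability (borel Y) R)
    (f : {mfun borel Y >-> borel Z}) :
  hausdorff_space Y -> hausdorff_space Z -> tight m ->
  (forall e : R, (0 < e)%R -> exists K : set Y, [/\ compact K,
     {within K, continuous (f : Y -> Z)} & m (~` K : set (borel Y)) <= e%:E]) ->
  tight (distribution m f).
Proof.
move=> hY hZ tm0 cptm; have tm := (tightP m hY).1 tm0.
apply: (tightP _ hZ).2 => A mA e e0.
have e20 : (0 < e / 2)%R by rewrite divr_gt0.
have mfA : measurable (f @^-1` A).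
  by rewrite -[X in measurable X]setTI; exact: measurable_funP.
have [K [cK Kcf mK]] := cptm _ e20; have [L [cL LA mL]] := tm _ mfA _ e20.
have cLK : compact (L `&` K) by exact: compact_closedI (compact_closed hY cK).
have cfLK : compact (f @` (L `&` K) : set Z).
  apply: continuous_compact => //; apply: continuous_subspaceW Kcf.
  exact: subIsetr.
exists (f @` (L `&` K)); split=> //; first by move=> _ [y [/LA Ly _] <-].
rewrite /distribution /pushforward/=.
have mLK := compact_borel hY cLK; have mbK := compact_borel hY cK.
have mCK : measurable (~` K : set (borel Y)) by exact: measurableC.
apply: (le_trans mL); rewrite [X in _ <= _ + X%:E]splitr EFinD addeA leeD2r//.
apply: (@le_trans _ _ (m ((L `&` K) `|` ~` K))).
  apply: le_measure; rewrite ?inE//; first exact: compact_borel.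
    exact: measurableU.
  by move=> x Lx; have [Kx|nKx] := pselect (K x); [left|right].
apply: (le_trans (measureU2 _ _ _)) => //; apply: leeD => //.
apply: le_measure; rewrite ?inE//; last by move=> x LKx; exists x.
rewrite -[X in measurable X]setTI; apply: measurable_funP => //.
exact: compact_borel.
Qed.

Local Close Scope ereal_scope.

Lemma measure_probability (d : measure_display) (T : measurableType d)
    (R : realType) (m : {measure set T -> \bar R}) : m setT = 1%E ->
  exists p : probability T R, p = m :> (set T -> \bar R).
Proof.
case: m => m mC /= mT.
pose mP := Measure_isProbability.Build _ T R (Measure.Pack mC) mT.
pose p : probability T R := HB.pack (Measure.sort (Measure.Pack mC)) mP.
by exists p.
Qed.

(** The Radon measure built from [lam] is bounded by [lam] on open sets and
    agrees with the outer approximation of [lam] on compact sets; the last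
    condition on [lam] therefore gives it total mass 1. *)
Lemma exists_tight_minorant (R : realType) (Y : ptopologicalType)
    (lam : set Y -> \bar R) : hausdorff_space Y ->
  open_content lam -> lam setT = 1%E ->
  (forall e : R, 0 < e -> exists K, compact K /\
    forall G, open G -> K `<=` G -> (1 <= lam G + e%:E)%E) ->
  exists m : probability (borel Y) R, tight m /\
    forall G : set Y, open G -> (m G <= lam G)%E.
Proof.
move=> hY lamP lamT cptlam; have [m0 m0E] := exists_radon_extension hY lamP.
have m0_open G : open G -> (m0 G <= lam G)%E.
  move=> oG; rewrite m0E radon_open//.
  by apply: ge_ereal_sup => _ [K [cK KG] <-]; exact: outer_open_le.
have m0_compact e : 0 < e -> exists K, compact K /\ (1 <= m0 K + e%:E)%E.
  move=> e0; have [K [cK Klam]] := cptlam _ e0; exists K; split => //.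
  rewrite m0E radon_compact// -leeBlDr//.
  apply: le_ereal_inf_tmp => _ [G [oG KG] <-].
  by rewrite leeBlDr//; exact: Klam.
have m0T : m0 setT = 1%E.
  apply/eqP; rewrite eq_le -{1}lamT m0_open/=; last exact: openT.
  apply/lee_addgt0Pr => e /m0_compact[K [cK Km0]]; apply: (le_trans Km0).
  rewrite leeD2r//; apply: le_measure => //; rewrite inE//.
  exact: compact_borel.
have [m mE] := measure_probability m0T; exists m.
rewrite -mE in m0E m0_open m0_compact.
split => //; apply: outer_regular_tight => // [A mA e e0|e e0].
  have mAfin : outer_open (inner_compact (outer_open lam)) A \is a fin_num.
    by rewrite -m0E; exact: (fin_num_measure m).
  have [_ [G [oG AG] <-] ltG] := lb_ereal_inf_adherent e0 mAfin.
  by exists G; split => //; rewrite m0E radon_open// ltW.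
have [K [cK Km0]] := m0_compact _ e0; exists K; split => //.
rewrite probability_setC; last exact: compact_borel.
have mKfin : m K \is a fin_num by apply: fin_num_measure; exact: compact_borel.
by rewrite leeBlDl.
Qed.

(** * Limits along an ultrafilter *)

Lemma ultra_cvg_compact (E : Type) (T : topologicalType) (UU : set_system E)
    (f : E -> T) (K : set T) : UltraFilter UU -> compact K ->
  (forall x, K (f x)) -> exists l : T, f @ UU --> l.
Proof.
move=> uUU cK Kf.
have FF : ProperFilter (f @ UU) by exact: fmap_proper_filter.
have FK : UU (f @^-1` K) by apply: filterE => x; exact: Kf.
have [p [_ clp]] := cK _ FF FK.
exists p => V pV.
have [//|UnV] := in_ultra_setVsetC (f @^-1` V) uUU.
by have [y []] := clp (~` V) _ UnV pV.
Qed.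

Lemma ler_cvg (R : realType) (E : Type) (F : set_system E) (f g : E -> R)
    (l l' : R) {FF : ProperFilter F} : f @ F --> l -> g @ F --> l' ->
  (forall x, f x <= g x) -> l <= l'.
Proof.
move=> fl gl' fg; apply/ler_addgt0Pr => e e0.
have e20 : 0 < e / 2 by rewrite divr_gt0.
have Ff : \forall x \near F, l - e / 2 < f x.
  by apply: (cvgr_gt l) => //; rewrite ltrBlDr ltrDl.
have Fg : \forall x \near F, g x < l' + e / 2.
  by apply: (cvgr_lt l') => //; rewrite ltrDl.
have [x [fx gx]] := filter_ex (filterI Ff Fg).
have := fg x; lra.
Qed.

Definition open_liminf_ge (R : realType) (Y : ptopologicalType) (E : Type)
    (F : set_system E) (m : E -> probability (borel Y) R)
    (p : probability (borel Y) R) : Prop :=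
  forall G : set Y, open G -> forall e : R, 0 < e ->
    \forall x \near F, (p G <= m x G + e%:E)%E.

(** Compactness of uniformly tight families.  The limits along [UU] of the
    masses of open sets form a content that need not be countably additive;
    it is replaced by a tight probability below it. *)
Lemma exists_ultra_limit (R : realType) (Y : ptopologicalType) (E : Type)
    (UU : set_system E) (m : E -> probability (borel Y) R) :
  hausdorff_space Y -> UltraFilter UU ->
  (forall e : R, 0 < e -> exists K : set Y, compact K /\
    forall x, (m x (~` K : set (borel Y)) <= e%:E)%E) ->
  exists rho : probability (borel Y) R, tight rho /\ open_liminf_ge UU m rho.
Proof.
move=> hY uUU cptm.
pose lam (A : set Y) : R := lim (fine (m x A) @[x --> UU]).
have cvlam (A : set Y) : measurable (A : set (borel Y)) ->
    fine (m x A) @[x --> UU] --> lam A.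
  move=> mA; have [|l ml] := @ultra_cvg_compact _ _ UU (fun x => fine (m x A)) _
    uUU (@segment_compact R 0 1).
    move=> x; rewrite /= in_itv/= fine_ge0//=.
    by rewrite -lee_fin fineK ?fin_num_measure// probability_le1.
  by rewrite /lam (cvg_lim _ ml).
have lamT : lam setT = 1.
  rewrite /lam; under eq_fun do rewrite probability_setT/=.
  by rewrite lim_cst.
have [||e e0|rho [trho rho_lam]] :=
    @exists_tight_minorant R Y (fun A => (lam A)%:E) hY.
- split.
  + rewrite /lam; under eq_fun do rewrite measure0/=.
    by rewrite lim_cst.
  + by rewrite ltry.
  + move=> G H /open_borel mG /open_borel mH GH; rewrite lee_fin.
    apply: (ler_cvg (cvlam _ mG) (cvlam _ mH)); move=> x.
    by rewrite -lee_fin !fineK ?fin_num_measure// le_measure// inE.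
  + move=> G H /open_borel mG /open_borel mH; rewrite -EFinD lee_fin.
    have mGH := measurableU _ _ mG mH.
    apply: (ler_cvg (cvlam _ mGH) (cvgD (cvlam _ mG) (cvlam _ mH))).
    move=> x; rewrite -lee_fin EFinD !fineK ?fin_num_measure//.
    exact: measureU2.
  + move=> G H /open_borel mG /open_borel mH GH0; rewrite -EFinD lee_fin.
    have mGH := measurableU _ _ mG mH.
    apply: (ler_cvg (cvgD (cvlam _ mG) (cvlam _ mH)) (cvlam _ mGH)).
    move=> x; rewrite -lee_fin EFinD !fineK ?fin_num_measure//.
    by rewrite measureU.
- by rewrite lamT.
- have [K [cK Km]] := cptm _ e0; exists K; split => // G oG KG.
  have mG := open_borel oG; rewrite -EFinD lee_fin -lerBlDr.
  apply: (ler_cvg (cvg_cst (1 - e)) (cvlam _ mG)); move=> x.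
  rewrite lerBlDr -lee_fin EFinD fineK ?fin_num_measure//.
  rewrite addeC -leeBlDr ?fin_num_measure// -probability_setC//.
  apply: le_trans (Km x); apply: le_measure; rewrite ?inE.
  + exact: measurableC.
  + by apply: measurableC; exact: compact_borel.
  + exact: subsetC.
exists rho; split => // G oG e e0; have mG := open_borel oG.
have : \forall x \near UU, lam G - e < fine (m x G).
  by apply: (cvgr_gt (lam G)); [exact: cvlam|rewrite ltrBlDr ltrDl].
apply: filterS => x lamx; apply: (le_trans (rho_lam _ oG)).
rewrite -[m x G]fineK ?fin_num_measure//.
by rewrite -EFinD lee_fin -lerBlDr ltW.
Qed.

(** * Upper semicontinuous functions and convergence of measures *)

Lemma wsc_cvg (R : realType) (Y : ptopologicalType) (E : Type)
    (F : set_system E) (m : E -> wsc_measure R Y) (m0 : wsc_measure R Y) :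
  Filter F ->
  (forall f : Y -> R, upper_semicontinuous f -> bounded_fun f ->
     forall a, wsc_int f m0 < a -> \forall x \near F, wsc_int f (m x) < a) ->
  m @ F --> m0.
Proof.
move=> FF mF V [W [[B Bfin <-] [A BA Am0]] WV].
suff FA : F (m @^-1` A) by apply: filterS FA => x Amx; apply: WV; exists A.
have [D Dsub DA] := Bfin _ BA; move: Am0; rewrite -DA => Am0.
rewrite preimage_bigcap; apply: filter_bigI => O DO.
have := Am0 _ DO; have := Dsub _ DO; rewrite inE => -[f [a [uf bf ->]]].
exact: mF.
Qed.

Lemma upper_semicontinuous_closed (R : realType) (Y : topologicalType)
    (f : Y -> R) (c : R) : upper_semicontinuous f -> closed [set y | c <= f y].
Proof.
move=> uf; rewrite (_ : [set y | _] = ~` [set y | f y < c]); last first.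
  by apply/seteqP; split=> y /=; rewrite leNgt => /negP.
by apply: open_closedC; rewrite openE => y /= fyc; exact: uf.
Qed.

Lemma upper_semicontinuous_measurable (R : realType) (Y : ptopologicalType)
    (f : Y -> R) : upper_semicontinuous f ->
  measurable_fun [set: borel Y] (f : borel Y -> R).
Proof.
move=> uf; apply: (measurability (@measurable_realfun.RGenInftyO.G R)).
  exact: measurable_realfun.RGenInftyO.measurableE.
move=> _ [_ [c ->] <-]; rewrite setTI.
apply: open_borel; rewrite openE => y /=; rewrite in_itv/= => fyc.
by apply: filterS (uf _ _ fyc) => z; rewrite /= in_itv.
Qed.

(** The number of levels [k < N] that [t] reaches approximates [t] within 1 as
    long as [t <= N]; the truncation at [N] on both sides is what makes the
    induction go through. *)
Lemma sum_level_bounds (R : realType) (N : nat) (t : R) : 0 <= t ->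
  Num.min t N%:R <= \sum_(k < N) (k%:R <= t)%R%:R <= Num.min (t + 1) N%:R.
Proof.
move=> t0; elim: N => [|N /andP[IH1 IH2]].
  by rewrite big_ord0 min_r// min_r ?lexx// addr_ge0.
rewrite big_ord_recr/= -[N.+1]addn1 natrD.
move: IH1 IH2; set s := \sum_(i < N) _.
rewrite !ge_min !le_min => IH1 /andP[s1 s2].
have st : Num.min t N%:R <= s by rewrite ge_min.
by case: (leP N%:R t) st => [Nt|tN] st; rewrite ?mulr1n ?mulr0n;
  apply/and3P; split; lra.
Qed.

Lemma Rintegral_sum_indic (R : realType) (d : measure_display)
    (T : measurableType d) (m : {finite_measure set T -> \bar R})
    (A : nat -> set T) (N : nat) : (forall k, measurable (A k)) ->
  m.-integrable setT (EFin \o (fun y => \sum_(k < N) \1_(A k) y)) /\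
  \int[m]_y (\sum_(k < N) \1_(A k) y) = \sum_(k < N) fine (m (A k)) :> R.
Proof.
move=> mA; elim: N => [|N [IH1 IH2]].
  split; last first.
    under eq_Rintegral do rewrite big_ord0.
    by rewrite big_ord0 Rintegral_cst// mul0r.
  rewrite (_ : _ \o _ = cst 0%E); first exact: integrable0.
  by apply/funext => y /=; rewrite big_ord0.
have i1 := integrable_indic m (mA N).
split.
  have -> : EFin \o (fun y => \sum_(k < N.+1) \1_(A k) y) =
    (EFin \o (fun y => \sum_(k < N) \1_(A k) y)) \+
    (fun y => (\1_(A N) y)%:E) :> (T -> \bar R).
    by apply/funext => y /=; rewrite big_ord_recr.
  exact: integrableD.
under eq_Rintegral do rewrite big_ord_recr/=.
rewrite RintegralD// IH2 big_ord_recr/=; congr (_ + _).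
by rewrite /Rintegral integral_indic// setIT.
Qed.

(** Slice [f] at the levels [c + k * h], where [- c] is a bound of [f]: the
    superlevel sets are closed, and [c + h * N] exceeds the range of [f]. *)
Lemma upper_semicontinuous_discretization (R : realType) (Y : ptopologicalType)
    (f : Y -> R) (h : R) : upper_semicontinuous f -> bounded_fun f -> 0 < h ->
  exists (N : nat) (c : R) (C : nat -> set Y), (forall k, closed (C k)) /\
    forall m : probability (borel Y) R,
      wsc_int f (wsc m) <= c + h * \sum_(k < N) fine (m (C k)) <=
        wsc_int f (wsc m) + h.
Proof.
move=> uf bf h0; have [M M0 fM] := ex_strict_bound_gt0 bf.
have {}fM y : `|f y| < M by exact: fM.
pose N := Num.bound (2 * M / h); pose C k := [set y | - M + k%:R * h <= f y].
have cC k : closed (C k) by exact: upper_semicontinuous_closed.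
exists N, (- M), C; split=> // m.
have mC k : measurable (C k : set (borel Y)) by exact: closed_borel.
have fif : m.-integrable setT (EFin \o (f : borel Y -> R)).
  apply: measurable_bounded_integrable => //.
  - by rewrite (le_lt_trans (probability_le1 m _)) ?ltry.
  - exact: upper_semicontinuous_measurable.
have icst c : m.-integrable setT (EFin \o (fun=> c : R)).
  exact: finite_measure_integrable_cst.
have [iS intS] := Rintegral_sum_indic m N mC.
pose s (y : borel Y) := \sum_(k < N) \1_(C k) y : R.
have ihs : m.-integrable setT (EFin \o (fun y => h * s y)).
  by apply: (integrableZl _ h iS).
have ig : m.-integrable setT (EFin \o (fun y => - M + h * s y)).
  exact: (integrableD _ (icst (- M)) ihs).
have ifh : m.-integrable setT (EFin \o (fun y : borel Y => f y + h)).
  exact: (integrableD _ fif (icst h)).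
have mT : fine (m setT) = 1 by rewrite probability_setT.
have intg : \int[m]_y (- M + h * s y) = - M + h * \sum_(k < N) fine (m (C k)).
  by rewrite RintegralD// RintegralZl// intS Rintegral_cst// mT mulr1.
have intfh : \int[m]_y (f y + h) = wsc_int f (wsc m) + h.
  by rewrite RintegralD// Rintegral_cst// mT mulr1.
have fg y : f y <= - M + h * s y <= f y + h.
  have sE : s y = \sum_(k < N) (k%:R <= (f y + M) / h)%R%:R.
    apply: eq_bigr => k _; rewrite indicE; congr (nat_of_bool _)%:R.
    apply/idP/idP => [/set_mem|]; rewrite ler_pdivlMr// /C/=.
      by rewrite addrC -lerBrDr opprK.
    by move=> kh; apply/mem_set => /=; rewrite addrC -lerBrDr opprK.
  have fy := fM y; have /andP[fy1 fy2] : - M < f y < M by rewrite -ltr_norml.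
  have t0 : 0 <= (f y + M) / h by rewrite divr_ge0 ?ltW//; lra.
  have tN : (f y + M) / h <= N%:R.
    apply: (@le_trans _ _ (2 * M / h)); last first.
      by apply/ltW/archi_boundP; rewrite divr_ge0 ?mulr_ge0 ?ltW.
    by rewrite ler_pM2r ?invr_gt0//; lra.
  have := sum_level_bounds N t0; rewrite -sE (min_idPl tN) => /andP[s1].
  rewrite le_min => /andP[s2 _].
  have -> : f y = - M + h * ((f y + M) / h).
    by rewrite mulrCA mulfV ?gt_eqF// mulr1; lra.
  have := ler_wpM2l (ltW h0) s1; have := ler_wpM2l (ltW h0) s2.
  rewrite mulrDr mulr1; lra.
by rewrite -intg -intfh; apply/andP; split; apply: le_Rintegral => // y _;
  have /andP[] := fg y.
Qed.

(** Lower bounds on open sets are upper bounds on their complements, as all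
    measures have mass 1, and these pass to the integral of a discretized
    function, which involves only finitely many closed sets. *)
Lemma open_liminf_wsc_cvg (R : realType) (Y : ptopologicalType) (E : Type)
    (F : set_system E) (m : E -> probability (borel Y) R)
    (m0 : probability (borel Y) R) : Filter F ->
  open_liminf_ge F m m0 ->
  (fun x => wsc (m x)) @ F --> wsc m0.
Proof.
move=> FF mG; apply: wsc_cvg => f uf bf a fa.
pose d := (a - wsc_int f (wsc m0)) / 2.
have d0 : 0 < d by rewrite divr_gt0// subr_gt0.
have [N [c [C [cC Cint]]]] := upper_semicontinuous_discretization uf bf d0.
have [eta [eta0 Neta]] : exists eta : R, 0 < eta /\ eta *+ N < 1.
  exists (N.+1%:R^-1); split; first by rewrite invr_gt0.
  by rewrite -[_ *+ N]mulr_natl ltr_pdivrMr ?ltr0n// mul1r ltr_nat.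
have : \forall x \near F, forall k : 'I_N,
    (m0 (~` C k) <= m x (~` C k) + eta%:E)%E.
  by apply: filter_forall => k; apply: mG => //; exact: closed_openC.
apply: filterS => x mx.
have /andP[mx1 _] := Cint (m x); have /andP[_ m02] := Cint m0.
apply: (le_lt_trans mx1).
have : \sum_(k < N) fine (m x (C k)) <=
    \sum_(k < N) (fine (m0 (C k)) + eta).
  apply: ler_sum => k _; have mC := closed_borel (cC k).
  have := mx k; rewrite !probability_setC//.
  rewrite -[m0 _]fineK ?fin_num_measure// -[m x _]fineK ?fin_num_measure//.
  rewrite -!EFinB -EFinD lee_fin/=.
  move: (fine (m0 _)) (fine (m x _)) => u v; lra.
rewrite big_split/= sumr_const card_ord => le1.
have := ler_wpM2l (ltW d0) le1; rewrite mulrDr.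
have : d * (eta *+ N) < d by rewrite gtr_pMr.
rewrite /d in m02 *; lra.
Qed.

(** The indicator of the complement of an open set is upper semicontinuous. *)
Lemma wsc_cvg_open_liminf (R : realType) (Y : ptopologicalType) (E : Type)
    (F : set_system E) (m : E -> probability (borel Y) R)
    (m0 : probability (borel Y) R) : Filter F ->
  (fun x => wsc (m x)) @ F --> wsc m0 ->
  open_liminf_ge F m m0.
Proof.
move=> FF mF G oG e e0.
have mG := open_borel oG.
pose f := \1_(~` G) : Y -> R.
have uf : upper_semicontinuous f.
  move=> y a; rewrite /f indicE; case: (boolP (y \in ~` G)) => [yG a1|].
    apply: filterE => z; apply: le_lt_trans a1.
    by rewrite indicE; case: (_ \in _).
  rewrite notin_setE => /contrapT Gy a0.
  apply: filterS (open_nbhs_nbhs (conj oG Gy)) => z Gz.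
  by rewrite indicE memNset//; apply.
have bf : bounded_fun f.
  exists 1; split=> // M M1 y _; apply: le_trans (ltW M1); rewrite /f indicE.
  by case: (_ \in _); rewrite /= ?normr0 ?normr1.
have intf (p : probability (borel Y) R) : wsc_int f (wsc p) = 1 - fine (p G).
  rewrite /wsc_int /Rintegral integral_indic ?setIT//; last exact: measurableC.
  rewrite -[X in fine X]/(p (~` G)) probability_setC// fineB//.
  exact: fin_num_measure.
have m0e : wsc_int f (wsc m0) < 1 - fine (m0 G) + e by rewrite intf ltrDl.
have : \forall x \near F, wsc_int f (wsc (m x)) < 1 - fine (m0 G) + e.
  exact: mF (wsc_int_upper_semicontinuous uf bf m0e).
apply: filterS => x; rewrite intf => mxe.
rewrite -[m0 G]fineK ?fin_num_measure// -[m x G]fineK ?fin_num_measure//.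
by rewrite -EFinD lee_fin; lra.
Qed.

(** * Tight limits, subnets and trajectory spaces *)

(** By symmetry, a net has at most one tight limit up to Borel sets.  For [K]
    compact, let [L] be a compact set that almost fills its complement for [q],
    and [U], [V] disjoint neighbourhoods of [K], [L]: then [p U] and [q V] are
    almost below [m x U] and [m x V], whose sum is at most 1. *)
Lemma tight_limit_le (R : realType) (Y : ptopologicalType) (E : Type)
    (F : set_system E) (m : E -> probability (borel Y) R)
    (p q : probability (borel Y) R) :
  hausdorff_space Y -> ProperFilter F -> tight p -> tight q ->
  open_liminf_ge F m p -> open_liminf_ge F m q ->
  forall A : set (borel Y), measurable A -> (p A <= q A)%E.
Proof.
move=> hY FF tp tq pm qm.
have pqK (K : set Y) : compact K -> (p K <= q K)%E.
  move=> cK; have mK := compact_borel hY cK.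
  apply/lee_addgt0Pr => e e0; have e30 : 0 < e / 3 by rewrite divr_gt0.
  have [L [cL LK qL]] := (tightP q hY).1 tq _ (measurableC mK) _ e30.
  have mL := compact_borel hY cL.
  have KL0 : K `&` L = set0 by rewrite -subset0 => y [Ky /LK].
  have [U [V [oU oV KU LV UV0]]] := hausdorff_compact_separation hY cK cL KL0.
  have mU := open_borel oU; have mV := open_borel oV.
  have [x [pU qV]] := filter_ex (filterI (pm _ oU _ e30) (qm _ oV _ e30)).
  have pKU : (p K <= p U)%E by apply: le_measure; rewrite ?inE.
  have qLV : (q L <= q V)%E by apply: le_measure; rewrite ?inE.
  have mUV : (m x U + m x V <= 1)%E.
    rewrite -measureU//; first by apply: probability_le1; exact: measurableU.
  have {}qL : (1 - q K <= q L + (e / 3)%:E)%E by rewrite -probability_setC.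
  move: pKU qLV mUV pU qV qL.
  rewrite -(fineK (fin_num_measure p _ mK)) -(fineK (fin_num_measure p _ mU)).
  rewrite -(fineK (fin_num_measure q _ mL)) -(fineK (fin_num_measure q _ mV)).
  rewrite -(fineK (fin_num_measure q _ mK)).
  rewrite -(fineK (fin_num_measure (m x) _ mU)).
  rewrite -(fineK (fin_num_measure (m x) _ mV)).
  rewrite -EFinB -!EFinD !lee_fin; lra.
move=> A mA; rewrite (tp A mA); apply: ge_ereal_sup => _ [K [cK KA] <-].
apply: (le_trans (pqK _ cK)); apply: le_measure; rewrite ?inE//.
exact: compact_borel.
Qed.

(** The subnet is indexed by the members of the filter with a marked element;
    refining a pair shrinks the set and moves the element forward, which makes
    the projection to the element monotone. *)
Lemma proper_filter_subnet (E : Type) (le : E -> E -> Prop)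
    (UU : set_system E) :
  directed le -> ProperFilter UU -> tails le `<=` UU ->
  exists (L : Type) (leL : L -> L -> Prop) (h : L -> E),
    [/\ directed leL, subnet_index le leL h & UU `<=` h @ tails leL].
Proof.
move=> [[e0 _] lexx letr ledir] UUP tUU.
pose L := {eA : E * set E | UU eA.2 /\ eA.2 eA.1}.
pose leL (a b : L) := le (projT1 a).1 (projT1 b).1 /\
  (projT1 b).2 `<=` (projT1 a).2.
have mkL A e : UU A -> A e -> UU (e, A).2 /\ (e, A).2 (e, A).1 by [].
exists L, leL, (fun a => (projT1 a).1); split.
- split.
  + by exists (exist _ (e0, setT) (mkL _ _ filterT I)).
  + by move=> a; split.
  + move=> a b c [ab1 ab2] [bc1 bc2]; split; first exact: letr bc1.
    exact: subset_trans ab2.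
  + move=> [[a A] /= aA] [[b B] /= bB].
    have tl c : UU [set d | le c d] by apply: tUU; exists c.
    have UAB : UU ((A `&` B) `&` ([set d | le a d] `&` [set d | le b d])).
      by apply: filterI; apply: filterI => //; [case: aA|case: bB].
    have [c [[Ac Bc] [ac bc]]] := filter_ex UAB.
    have UABi : UU (A `&` B) by apply: filterI; [case: aA|case: bB].
    exists (exist _ (c, A `&` B) (mkL _ _ UABi (conj Ac Bc))); split => //=;
      by [exact: subIsetl|exact: subIsetr].
- split; first by move=> a b [].
  by move=> e; exists (exist _ (e, setT) (mkL _ _ filterT I)); exact: lexx.
- move=> A UA; have [e Ae] := filter_ex UA.
  exists (exist _ (e, A) (mkL _ _ UA Ae)) => // -[[b B] [UB Bb]] [/= _ BA].
  exact: BA.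
Qed.

(** A compact subset of the union lies in a single member of the family. *)
Lemma tight_directed_bigcup (R : realType) (Y : ptopologicalType) (E : Type)
    (le : E -> E -> Prop) (m : probability (borel Y) R) (G : E -> set Y)
    (c : \bar R) :
  hausdorff_space Y -> directed le -> tight m -> (forall a, open (G a)) ->
  (forall a b, le a b -> G a `<=` G b) -> (forall a, (m (G a) <= c)%E) ->
  (m (\bigcup_a G a) <= c)%E.
Proof.
move=> hY /tails_filter tF tm oG homoG mG.
have mUG : measurable (\bigcup_a G a : set (borel Y)).
  by apply: open_borel; apply: bigcup_open => a _; exact: oG.
rewrite (tm _ mUG); apply: ge_ereal_sup => _ [K [cK KG] <-].
have : \forall a \near tails le, K `<=` G a.
  have /compact_near_coveringP := cK; apply => x /KG[a _ Gax].
  exists (G a, [set b | le a b]) => /=.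
    by split; [exact: open_nbhs_nbhs|exists a].
  by move=> [y b] [/= Gay ab]; exact: homoG ab _ Gay.
move=> /filter_ex[a KGa]; apply: le_trans (mG a); apply: le_measure => //.
  by rewrite inE; exact: compact_borel.
by rewrite inE; exact: open_borel.
Qed.

Lemma Cloc_hausdorff (T : topologicalType) (X : ptopologicalType) :
  hausdorff_space X -> hausdorff_space (Cloc T X).
Proof.
rewrite !open_hausdorff => hX u v uv.
have [t ut] : exists t, Pi t u != Pi t v.
  apply: contrapT => /forallNP uvE; move/eqP: uv; apply.
  apply/continuousEP => t; apply/eqP; apply: contrapT => /negP; exact: uvE.
have [[A B] /= [uA vB] [oA oB AB0]] := hX _ _ ut.
exists ((Pi t : Cloc T X -> X) @^-1` A, (Pi t : Cloc T X -> X) @^-1` B) => /=.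
  by move: uA vB; rewrite !inE.
have /continuousP Pic := @Pi_continuous T X t.
split; [exact: Pic|exact: Pic|].
by rewrite -preimage_setI (eqP AB0) preimage_set0.
Qed.

Lemma cvg0_le (R : realType) (delta : nat -> R) (e : R) :
  delta @ \oo --> 0 -> 0 < e -> exists n, delta n <= e.
Proof.
move=> d0 e0; have : \forall n \near \oo, delta n < e by exact: (cvgr_lt 0).
by move=> /filter_ex[n /ltW]; exists n.
Qed.

(** * Convergence of trajectory statistical solutions *)

Theorem theorem3p2 (R : realType) (X : ptopologicalType)
  (hX : hausdorff_space X)
  (I : set R) (hI : is_interval I) (t0 : I) (ht0 : lbound I (\val t0))
  (U : set (Cloc I X))
  (E : Type) (le : E -> E -> Prop) (hE : directed le)
  (S : E -> {mfun borel X >-> borel (Cloc I X)})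
  (mu : E -> probability (borel X) R) (hmu : forall e, tight (mu e))
  (mu0 : probability (borel X) R) (hmu0 : tight mu0)
  (H1 : (fun e => wsc (distribution (mu e) (Pi t0 \o S e))) @ tails le
          --> wsc mu0)
  (K : nat -> set X) (hK : forall n, compact (K n))
  (H2 : forall n e, {within K n, continuous (S e : X -> Cloc I X)})
  (delta : nat -> R) (hdelta : delta @ \oo --> 0)
  (H3 : forall e n, (mu e (~` K n) <= (delta n)%:E)%E)
  (H4 : forall n, exists KK : set (Cloc I X),
     compact KK /\ forall e, S e @` K n `<=` KK)
  (H5 : forall n, @net_limsup E le (Cloc I X) (fun e => S e @` K n) `<=` U) :
  (forall e, trajectory_statistical_solution
     (range (S e)) (distribution (mu e) (S e))) /\
  exists rho : probability (borel (Cloc I X)) R,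
    [/\ trajectory_statistical_solution U rho,
        exists (L : Type) (leL : L -> L -> Prop) (h : L -> E),
          [/\ directed leL, subnet_index le leL h &
              (fun l => wsc (distribution (mu (h l)) (S (h l)))) @ tails leL
                --> wsc rho] &
        forall A : set (borel X), measurable A ->
          distribution rho (Pi t0) A = mu0 A].
Proof.
have hC : hausdorff_space (Cloc I X) by exact: Cloc_hausdorff.
have mKn n : measurable (K n : set (borel X)) by exact: compact_borel.
have small (eps : R) : 0 < eps ->
    exists n, forall e, (mu e (~` K n) <= eps%:E)%E.
  move=> /(cvg0_le hdelta)[n dn]; exists n => e.
  by apply: le_trans (H3 e n) _; rewrite lee_fin.
have mS e (A : set (borel (Cloc I X))) :
    measurable A -> measurable (S e @^-1` A).
  by move=> mA; rewrite -[X in measurable X]setTI; exact: measurable_funP.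
pose m e : probability (borel (Cloc I X)) R := distribution (mu e) (S e).
(* The preimage of [~` A] under [S e] misses [K n]. *)
have mnull e n (A : set (borel (Cloc I X))) : measurable A ->
    S e @` K n `<=` A -> (m e (~` A) <= (delta n)%:E)%E.
  move=> mA SKA; apply: le_trans (H3 e n).
  rewrite -[m e _]/(mu e (S e @^-1` (~` A))); apply: le_measure; rewrite ?inE.
  - by apply: mS; exact: measurableC.
  - exact: measurableC.
  - by move=> x nAx Kx; apply: nAx; apply: SKA; exists x.
split=> [e|].
  split.
    apply: tight_pushforward => // eps /small[n mun].
    by exists (K n); split.
  exists (\bigcup_n (S e @` K n)); split.
  - apply: bigcupT_measurable => n; apply: compact_borel => //.
    exact: continuous_compact.
  - by move=> _ [n _ [x _ <-]]; exists x.
  - have mV : measurable (\bigcup_n (S e @` K n) : set (borel (Cloc I X))).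
      apply: bigcupT_measurable => n; apply: compact_borel => //.
      exact: continuous_compact.
    apply/eqP; rewrite -measure_le0; apply/lee_addgt0Pr => eps.
    move=> /(cvg0_le hdelta)[n dn]; rewrite add0e.
    apply: (@le_trans _ _ (delta n)%:E); last by rewrite lee_fin.
    by apply: mnull => // u Su; exists n.
have tF := tails_filter hE.
have [UU [uUU tUU]] := ultraFilterLemma tF.
have [rho [trho rhom]] : exists rho : probability (borel (Cloc I X)) R,
    tight rho /\ open_liminf_ge UU m rho.
  apply: exists_ultra_limit => // eps /(cvg0_le hdelta)[n dn].
  have [KK [cKK SKK]] := H4 n; exists KK; split => // e.
  apply: (@le_trans _ _ (delta n)%:E); last by rewrite lee_fin.
  by apply: mnull => //; exact: compact_borel.
exists rho; split.
- split=> //.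
  pose F n a : set (Cloc I X) :=
    closure (\bigcup_(b in [set b | le a b]) (S b @` K n)).
  have cF n a : closed (F n a) by exact: closed_closure.
  have cA n : closed (net_limsup le (fun e => S e @` K n)).
    by apply: closed_bigI => a _; exact: cF.
  have rhoA n :
      (rho (~` net_limsup le (fun e => S e @` K n)) <= (delta n)%:E)%E.
    rewrite /net_limsup setC_bigcap.
    apply: (@tight_directed_bigcup _ _ _ le) => //.
    + by move=> a; exact: closed_openC (cF n a).
    + move=> a b ab; apply: subsetC; apply: closure_subset.
      case: hE => _ _ letr _.
      by apply: bigcup_subset => c bc; exact: letr bc.
    + move=> a; apply/lee_addgt0Pr => eps eps0.
      (* Members of [UU] meet every tail, so some index [b] above [a] is at
         hand, and [F n a] contains the image of [K n] under [S b]. *)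
      have Ua : UU [set b | le a b] by apply: tUU; exists a.
      have [b [ab mb]] :=
        filter_ex (filterI Ua (rhom _ (closed_openC (cF n a)) _ eps0)).
      apply: (le_trans mb); rewrite leeD2r//; apply: mnull.
        exact: closed_borel.
      by apply: subset_trans (@subset_closure _ _) => u Su; exists b.
  have mA n := closed_borel (cA n).
  exists (\bigcup_n net_limsup le (fun e => S e @` K n)); split.
  + exact: bigcupT_measurable.
  + by move=> u [n _]; exact: H5.
  + apply/eqP; rewrite -measure_le0; apply/lee_addgt0Pr => eps.
    move=> /(cvg0_le hdelta)[n dn]; rewrite add0e.
    apply: (@le_trans _ _ (delta n)%:E); last by rewrite lee_fin.
    apply: le_trans (rhoA n); apply: le_measure; rewrite ?inE.
    * by apply: measurableC; exact: bigcupT_measurable.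
    * exact: measurableC.
    * by apply: subsetC => u Au; exists n.
- have [L [leL [h [dL sh hU]]]] :=
    proper_filter_subnet hE ultra_proper tUU.
  exists L, leL, h; split => //.
  have FL := tails_filter dL.
  apply: open_liminf_wsc_cvg => G oG eps eps0; exact: hU _ (rhom _ oG _ eps0).
- move=> A mA.
  have trhoPi : tight (distribution rho (Pi t0)).
    apply: tight_pushforward => // eps eps0.
    have [L [cL _ rhoL]] := (tightP rho hC).1 trho _ measurableT _ eps0.
    have mL := compact_borel hC cL.
    exists L; split => //.
      by apply: continuous_subspaceT; exact: Pi_continuous.
    rewrite probability_setC//; rewrite leeBlDl ?fin_num_measure//.
    by rewrite -(probability_setT rho).
  (* The laws of the initial values [Pi t0 \o S e] have two tight limits
     along [UU]. *)
  pose m' e : probability (borel X) R := distribution (mu e) (Pi t0 \o S e).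
  have mu0m : open_liminf_ge UU m' mu0.
    by move=> G oG e e0; apply: tUU; exact: (wsc_cvg_open_liminf tF H1).
  have Pim : open_liminf_ge UU m' (distribution rho (Pi t0)).
    move=> G oG; apply: (rhom (Pi t0 @^-1` G)).
    by have /continuousP := @Pi_continuous I X t0; apply.
  apply/eqP; rewrite eq_le; apply/andP; split.
    exact: (tight_limit_le hX _ trhoPi hmu0 Pim mu0m).
  exact: (tight_limit_le hX _ hmu0 trhoPi mu0m Pim).
Qed.
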